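(* Let $f(X;W)=\overline{O}(\overline{I}(X)\,\overline{P}(W))$ be an $(\overline{O},\overline{I},\overline{P})$-expressible layer with $\overline{I}(X)\in\mathbb{R}^{G\times N\times I}$ and $\overline{P}(W)\in\mathbb{R}^{G\times I\times O}$, where $X$ is the (calibration) input of the layer and $W$ its parameter tensor. For each group $g\in\{1,\dots,G\}$ let $M_g\in\mathbb{R}^{I\times I}$ be an uncentered whitening matrix for $\overline{I}(X)_g\in\mathbb{R}^{N\times I}$, and let $P\in\{1,\dots,\min(I,O)\}$. Then the activation-aware rank-$P$ projection, given groupwise by $\mathcal{T}^{\mathrm{AA}}_P(\overline{P}(W))_g=M_g\,\mathcal{T}^{\mathrm{SVD}}_P\bigl(M_g^{+}\,\overline{P}(W)_g\bigr)$, is optimal, i.e. $$\bigl\|\overline{I}(X)\overline{P}(W)-\mathcal{T}^{\mathrm{SVD}}_P\bigl(\overline{I}(X)\overline{P}(W)\bigr)\bigr\|_F=\bigl\|\overline{I}(X)\overline{P}(W)-\overline{I}(X)\,\mathcal{T}^{\mathrm{AA}}_P\bigl(\overline{P}(W)\bigr)\bigr\|_F ,$$ where matrix products and $\mathcal{T}^{\mathrm{SVD}}_P$ act independently on each group.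
   Context: **Tensors and batched operations.** All tensors are real. $\|\cdot\|_F$ is the tensor Frobenius norm (the Euclidean norm of the flattened tensor). For third-order tensors $A\in\mathbb{R}^{G\times N\times I}$ and $C\in\mathbb{R}^{G\times I\times O}$, the product $AC\in\mathbb{R}^{G\times N\times O}$ is batched: $(AC)_g=A_gC_g$ for $g=1,\dots,G$. $G$ is called the number of groups. **Expressible layers.** A layer $f$ is $(\overline{O},\overline{I},\overline{P})$-expressible if $f(X;W)=\overline{O}(\overline{I}(X)\,\overline{P}(W))$, where $\overline{O}$ (defined on $\mathbb{R}^{G\times N\times O}$) and $\overline{P}$ (with values in $\mathbb{R}^{G\times I\times O}$) are compositions of reshape and permute-axes operators (hence bijections that only rearrange entries), and $\overline{I}$ is a linear operator with values in $\mathbb{R}^{G\times N\times I}$. **Truncated SVD.** For a matrix $A$ with SVD $A=U\Sigma V^\top$ (singular values in decreasing order), $\mathcal{T}^{\mathrm{SVD}}_P(A)=U_{:,:P}\,\Sigma_{:P,:P}\,(V_{:,:P})^\top$ keeps the $P$ largest singular values and their singular vectors; if the SVD is not unique, an arbitrary one is fixed. On a batch of matrices it acts on each group separately with the same $P$. **Uncentered whitening matrix.** For $X'\in\mathbb{R}^{N\times I}$ of rank $R$ (possibly $R<I$), a matrix $M\in\mathbb{R}^{I\times I}$ is an uncentered whitening matrix for $X'$ if $M^\top X'^\top X' M=N\,\overline{\mathbf I}_R$ and $\operatorname{range}(M)=\operatorname{row}(X')$, where $\overline{\mathbf I}_R\in\mathbb{R}^{I\times I}$ is the diagonal matrix with ones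 in the first $R$ diagonal positions and zeros elsewhere, and $\operatorname{row}(X')\subseteq\mathbb{R}^I$ is the row space. $M^{+}$ denotes the Moore–Penrose inverse of $M$. *)

(* Defs.v *)
From HB Require Import structures.
From mathcomp Require Import all_boot all_order all_fingroup all_algebra.

Set Implicit Arguments.
Unset Strict Implicit.
Unset Printing Implicit Defensive.

Import Order.TTheory GRing.Theory Num.Theory.
Local Open Scope ring_scope.

(* Multi-indices of the shape [:: d1; ..; dk] are nested pairs
   (i1, (i2, .. (ik, tt))) with ij : 'I_dj. *)
Fixpoint midx (s : seq nat) : finType :=
  if s is d :: s' then ('I_d * midx s')%type : finType else unit.

(* R^o is R seen as a module over itself, so that tensors form a module. *)
Notation tensor R s := {ffun midx s -> R^o}.

Definition numel (s : seq nat) : nat := (\prod_(d <- s) d)%N.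

Fixpoint coords (s : seq nat) : midx s -> seq nat :=
  if s is d :: s' then fun i => (i.1 : nat) :: coords i.2 else fun=> [::].

(* Row-major position in the flattened tensor; a bijection from midx s onto
   [0, numel s). *)
Fixpoint flat (s : seq nat) : midx s -> nat :=
  if s is d :: s' then fun i => (i.1 * numel s' + flat i.2)%N else fun=> 0%N.

Definition frobenius (R : rcfType) (s : seq nat) (T : tensor R s) : R :=
  Num.sqrt (\sum_i T i ^+ 2).

Definition is_reshape (R : rcfType) (s t : seq nat)
    (f : tensor R s -> tensor R t) : Prop :=
  numel s = numel t /\
  forall T (i : midx s) (j : midx t), flat i = flat j -> f T j = T i.

(* Axis k of the result is axis p k of the argument. *)
Definition is_permute_axes (R : rcfType) (s t : seq nat)
    (f : tensor R s -> tensor R t) : Prop :=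
  exists p : 'S_(size s),
    t = [seq nth 0%N s (p k) | k : 'I_(size s)] /\
    forall T (i : midx s) (j : midx t),
      coords j = [seq nth 0%N (coords i) (p k) | k : 'I_(size s)] ->
      f T j = T i.

Inductive rearrangement (R : rcfType) :
    forall s t : seq nat, (tensor R s -> tensor R t) -> Prop :=
| Rearr_reshape s t (f : tensor R s -> tensor R t) :
    is_reshape f -> rearrangement f
| Rearr_permute s t (f : tensor R s -> tensor R t) :
    is_permute_axes f -> rearrangement f
| Rearr_comp s t u (f : tensor R s -> tensor R t) (g : tensor R t -> tensor R u) :
    rearrangement f -> rearrangement g -> rearrangement (g \o f).

Definition slice (R : rcfType) (G m n : nat) (T : tensor R [:: G; m; n])
    (g : 'I_G) : 'M[R]_(m, n) :=
  \matrix_(i, j) T (g, (i, (j, tt))).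

Definition batch (R : rcfType) (G m n : nat) (F : 'I_G -> 'M[R]_(m, n)) :
    tensor R [:: G; m; n] :=
  [ffun i : midx [:: G; m; n] => F i.1 i.2.1 i.2.2.1].

Definition bmul (R : rcfType) (G m n p : nat)
    (A : tensor R [:: G; m; n]) (B : tensor R [:: G; n; p]) :
    tensor R [:: G; m; p] :=
  batch (fun g => slice A g *m slice B g).

Definition expressible (R : rcfType) (G N I O : nat) (sX sW sY : seq nat)
    (f : tensor R sX -> tensor R sW -> tensor R sY)
    (Ob : tensor R [:: G; N; O] -> tensor R sY)
    (Ib : {linear tensor R sX -> tensor R [:: G; N; I]})
    (Pb : tensor R sW -> tensor R [:: G; I; O]) : Prop :=
  [/\ rearrangement Ob, rearrangement Pb
    & forall X W, f X W = Ob (bmul (Ib X) (Pb W))].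

Definition is_svd (R : rcfType) (m n : nat) (A : 'M[R]_(m, n))
    (usv : 'M[R]_m * 'M[R]_(m, n) * 'M[R]_n) : Prop :=
  let: (U, D, V) := usv in
  [/\ U^T *m U = 1%:M, V^T *m V = 1%:M, A = U *m D *m V^T
    & [/\ is_diag_mx D, forall i j, 0 <= D i j
        & forall (i i' : 'I_m) (j j' : 'I_n),
            i = j :> nat -> i' = j' :> nat -> (i <= i')%N -> D i' j' <= D i j]].

(* As usual for the slices U_{:,:P} and D_{:P,:P}, P is capped at the number of
   available rows or columns. *)
Definition first_cols (R : rcfType) (m n P : nat) (U : 'M[R]_(m, n)) :
    'M[R]_(m, minn P n) :=
  colsub (widen_ord (geq_minr P n)) U.

Definition leading_block (R : rcfType) (m n P : nat) (D : 'M[R]_(m, n)) :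
    'M[R]_(minn P m, minn P n) :=
  mxsub (widen_ord (geq_minr P m)) (widen_ord (geq_minr P n)) D.

(* SVDs are not unique: svd fixes one for every matrix. *)
Definition tsvd (R : rcfType)
    (svd : forall m n, 'M[R]_(m, n) -> 'M[R]_m * 'M[R]_(m, n) * 'M[R]_n)
    (P m n : nat) (A : 'M[R]_(m, n)) : 'M[R]_(m, n) :=
  let: (U, D, V) := svd m n A in
  first_cols P U *m leading_block P D *m (first_cols P V)^T.

Definition btsvd (R : rcfType)
    (svd : forall m n, 'M[R]_(m, n) -> 'M[R]_m * 'M[R]_(m, n) * 'M[R]_n)
    (P G m n : nat) (T : tensor R [:: G; m; n]) : tensor R [:: G; m; n] :=
  batch (fun g => tsvd svd P (slice T g)).

(* MacDuffee's formula for the full-rank factorization A = C *m F. MathComp's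
   pinvmx is only a generalized inverse. *)
Definition mpinv (R : rcfType) (m n : nat) (A : 'M[R]_(m, n)) : 'M[R]_(n, m) :=
  let C := col_base A in let F := row_base A in
  F^T *m invmx (F *m F^T) *m (invmx (C^T *m C) *m C^T).

Lemma row_free_gram (R : rcfType) (m n : nat) (F : 'M[R]_(m, n)) :
  row_free F -> F *m F^T \in unitmx.
Proof.
move=> Ffree; rewrite -row_free_unit -kermx_eq0; apply/rowV0P => v.
move=> /sub_kermxP vFF; have vF : v *m F = 0.
  have : (v *m F) *m (v *m F)^T = 0.
    by rewrite trmx_mul mulmxA -[v *m F *m _]mulmxA vFF mul0mx.
  move: (v *m F) => u /matrixP/(_ 0 0); rewrite !mxE => /eqP.
  rewrite psumr_eq0 => [/allP h|j _]; last by rewrite mxE -expr2 sqr_ge0.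
  apply/rowP => j; have := h j (mem_index_enum j).
  by rewrite !mxE /= -expr2 sqrf_eq0 => /eqP.
by apply: (row_free_inj Ffree); rewrite vF mul0mx.
Qed.

Lemma mpinvP (R : rcfType) (m n : nat) (A : 'M[R]_(m, n)) :
  [/\ A *m mpinv A *m A = A, mpinv A *m A *m mpinv A = mpinv A,
      (A *m mpinv A)^T = A *m mpinv A & (mpinv A *m A)^T = mpinv A *m A].
Proof.
rewrite /mpinv; have := mulmx_base A.
have: row_free (row_base A) by apply: row_base_free.
have: row_full (col_base A) by apply: col_base_full.
move: (\rank A) (col_base A) (row_base A) => r C F Cfull Ffree AE.
have uF : F *m F^T \in unitmx by apply: row_free_gram.
have uC : C^T *m C \in unitmx.
  rewrite -[C in X in _ *m X]trmxK; apply: row_free_gram.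
  by rewrite /row_free mxrank_tr.
set B := _ *m (_ *m C^T).
have AB : A *m B = C *m (invmx (C^T *m C) *m C^T).
  by rewrite -[in LHS]AE /B !mulmxA -(mulmxA C F) mulmxK.
have BA : B *m A = F^T *m invmx (F *m F^T) *m F.
  by rewrite -[in LHS]AE /B -!mulmxA (mulmxA C^T C) mulKmx.
have sF : (invmx (F *m F^T))^T = invmx (F *m F^T).
  by rewrite trmx_inv trmx_mul trmxK.
have sC : (invmx (C^T *m C))^T = invmx (C^T *m C).
  by rewrite trmx_inv trmx_mul trmxK.
split; rewrite ?AB ?BA.
- by rewrite -AE -!mulmxA (mulmxA C^T C) mulKmx.
- by rewrite /B !mulmxA -(mulmxA _ F F^T) mulmxKV.
- by rewrite !trmx_mul trmxK sC mulmxA.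
- by rewrite !trmx_mul trmxK sF mulmxA.
Qed.

(* (M^T == X)%MS compares row spaces: range(M), the column space of M, is the
   row space of M^T. *)
Definition whitening (R : rcfType) (N I : nat) (X : 'M[R]_(N, I))
    (M : 'M[R]_I) : Prop :=
  M^T *m X^T *m X *m M = N%:R *: pid_mx (\rank X) /\ (M^T == X)%MS.

Definition taa (R : rcfType)
    (svd : forall m n, 'M[R]_(m, n) -> 'M[R]_m * 'M[R]_(m, n) * 'M[R]_n)
    (P G I O : nat) (M : 'I_G -> 'M[R]_I) (W : tensor R [:: G; I; O]) :
    tensor R [:: G; I; O] :=
  batch (fun g => M g *m tsvd svd P (mpinv (M g) *m slice W g)).

(* Main.v *)
(** The columns of [M] beyond the rank [r] of [X] vanish, and [M M^+] is the
    orthogonal projector onto the row space of [X]; hence [X W = (X M) (M^+ W)],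
    where [(X M)^T (X M) = N I_r] and [Z = M^+ W] is supported on its first [r]
    rows. So left multiplication by [X M] scales Frobenius norms of the relevant
    matrices by [sqrt N], and [(X W)^T (X W) = N Z^T Z]. The truncation error of
    a matrix [A] is the sum of the trailing eigenvalues of [A^T A], which are
    determined by its characteristic polynomial, whatever SVD is chosen. *)
Require Import Defs.
From HB Require Import structures.
From mathcomp Require Import all_boot all_order all_fingroup all_algebra.

Set Implicit Arguments.
Unset Strict Implicit.
Unset Printing Implicit Defensive.

Import Order.TTheory GRing.Theory Num.Theory.
Local Open Scope ring_scope.

(** * Squared Frobenius norms as traces of Gram matrices, group by group *)

Definition sqnorm (R : pzRingType) (m n : nat) (A : 'M[R]_(m, n)) : R :=
  \tr (A^T *m A).

Lemma sqnormE (R : pzRingType) (m n : nat) (A : 'M[R]_(m, n)) :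
  sqnorm A = \sum_i \sum_j A i j ^+ 2.
Proof.
rewrite exchange_big /sqnorm /mxtrace; apply: eq_bigr => j _.
by rewrite mxE; apply: eq_bigr => i _; rewrite mxE expr2.
Qed.

Lemma gram_eq0 (R : rcfType) (m n : nat) (A : 'M[R]_(m, n)) :
  A^T *m A = 0 -> A = 0.
Proof.
move=> A0; have := sqnormE A; rewrite /sqnorm A0 mxtrace0 => /esym/eqP.
rewrite psumr_eq0 => [/allP h|i _]; last by apply: sumr_ge0 => j _; exact: sqr_ge0.
apply/matrixP => i j; have := h i (mem_index_enum i); rewrite /=.
rewrite psumr_eq0 => [/allP/(_ j (mem_index_enum j))|k _]; last exact: sqr_ge0.
by rewrite /= sqrf_eq0 mxE => /eqP.
Qed.

Lemma frobenius_slice (R : rcfType) (G m n : nat) (T : tensor R [:: G; m; n]) :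
  frobenius T = Num.sqrt (\sum_g sqnorm (slice T g)).
Proof.
rewrite /frobenius; congr Num.sqrt.
under [RHS]eq_bigr => g _ do (rewrite sqnormE pair_big /=).
rewrite pair_big /=.
(* Multi-indices end in a dummy [tt]; the bijection drops it. *)
rewrite (reindex (fun p : 'I_G * ('I_m * 'I_n) => (p.1, (p.2.1, (p.2.2, tt))))) /=.
  by apply: eq_bigr => -[g [i j]] _ /=; rewrite mxE.
exists (fun p => (p.1, (p.2.1, p.2.2.1))); first by move=> [? [? ?]].
by move=> [? [? [? []]]].
Qed.

Lemma sliceB (R : rcfType) (G m n : nat) (S T : tensor R [:: G; m; n]) g :
  slice (S - T) g = slice S g - slice T g.
Proof. by apply/matrixP => i j; rewrite !mxE !ffunE. Qed.

Lemma slice_batch (R : rcfType) (G m n : nat) (F : 'I_G -> 'M[R]_(m, n)) g :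
  slice (batch F) g = F g.
Proof. by apply/matrixP => i j; rewrite !mxE ffunE. Qed.

(** * Uniqueness of the ordered spectrum *)

Lemma char_poly_conj (R : comNzRingType) (n : nat) (V V' D : 'M[R]_n) :
  V *m V' = 1%:M -> char_poly (V *m D *m V') = char_poly D.
Proof.
move=> VV'; rewrite /char_poly.
have -> : char_poly_mx (V *m D *m V') =
    map_mx polyC V *m char_poly_mx D *m map_mx polyC V'.
  rewrite /char_poly_mx mulmxBr mulmxBl !map_mxM scalar_mxC -(mulmxA 'X%:M).
  by rewrite -(map_mxM polyC V V') VV' map_mx1 mulmx1.
rewrite !det_mulmx mulrAC -det_mulmx -(map_mxM polyC V V') VV'.
by rewrite map_mx1 det1 mul1r.
Qed.

(** Orthogonal conjugation preserves the characteristic polynomial, so both diagonals list the same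
    roots with multiplicity; a decreasing list is determined by its multiset. *)
Lemma sorted_diag_uniq (R : rcfType) (n : nat) (D E V U : 'M[R]_n) :
  is_diag_mx D -> is_diag_mx E ->
  {homo (fun i => D i i) : i j / (i <= j)%N >-> j <= i} ->
  {homo (fun i => E i i) : i j / (i <= j)%N >-> j <= i} ->
  V *m V^T = 1%:M -> U *m U^T = 1%:M ->
  V *m D *m V^T = U *m E *m U^T -> D = E.
Proof.
move=> dD dE sD sE VV UU eqDE.
have cDE : char_poly D = char_poly E.
  by rewrite -(char_poly_conj D VV) eqDE (char_poly_conj E UU).
have perm_diag : perm_eq [seq D i i | i : 'I_n] [seq E i i | i : 'I_n].
  apply: prod_XsubC_eq; rewrite !big_image /=.
  by rewrite -!char_poly_trig ?cDE // is_diag_mx_is_trig.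
have sorted_diag (F : 'M[R]_n) :
    {homo (fun i => F i i) : i j / (i <= j)%N >-> j <= i} ->
    sorted (>=%R) [seq F i i | i : 'I_n].
  move=> sF; rewrite sorted_map sorted_pairwise; last first.
    by move=> i j k /= hij hjk; apply: le_trans hij.
  have : sorted ltn (map val (enum 'I_n)) by rewrite val_enum_ord iota_ltn_sorted.
  rewrite sorted_map sorted_pairwise => [|i j k /=]; last exact: ltn_trans.
  by apply: sub_pairwise => i j /= /ltnW /sF.
have eq_diag : [seq D i i | i : 'I_n] = [seq E i i | i : 'I_n].
  apply: (sorted_eq _ _ (sorted_diag _ sD) (sorted_diag _ sE) perm_diag).
    by move=> x y z h1 h2; apply: le_trans h1.
  by move=> x y /andP[h1 h2]; apply/le_anti/andP.
apply/matrixP => i j; case: (eqVneq i j) => [<-|ij].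
  by move/eq_in_map: eq_diag; apply; rewrite mem_enum.
by rewrite (is_diag_mxP dD) // (is_diag_mxP dE).
Qed.

(** * Truncated SVD and its error *)

Lemma first_colsE (R : rcfType) (m n P : nat) (U : 'M[R]_(m, n)) :
  first_cols P U = U *m pid_mx (minn P n).
Proof.
apply/matrixP => i j; rewrite !mxE (bigD1 (widen_ord (geq_minr P n) j)) //=.
rewrite mxE /= eqxx ltn_ord mulr1 big1 ?addr0 // => k kj.
by rewrite mxE (negPf (_ : (k : nat) != j)) ?mulr0.
Qed.

Lemma leading_blockE (R : rcfType) (m n P : nat) (D : 'M[R]_(m, n)) :
  leading_block P D = pid_mx (minn P m) *m D *m pid_mx (minn P n).
Proof.
rewrite -first_colsE; apply/matrixP => i j; rewrite !mxE.
rewrite (bigD1 (widen_ord (geq_minr P m) i)) //=.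
rewrite mxE /= eqxx ltn_ord mul1r big1 ?addr0 // => k ki.
by rewrite mxE (negPf (_ : (i : nat) != k)) ?mul0r // eq_sym.
Qed.

Lemma diag_pid_mx (R : pzRingType) (m n P : nat) (D : 'M[R]_(m, n)) :
  is_diag_mx D -> pid_mx P *m D = D *m pid_mx P.
Proof.
move=> /is_diag_mxP dD; apply/matrixP => i j; rewrite !mxE.
rewrite (bigD1 i) //= [RHS](bigD1 j) //= !mxE !eqxx /=.
rewrite !big1 ?addr0 => [|k kj|k ki].
- have [->|/dD ->] := eqVneq (i : nat) j; last by rewrite mulr0 mul0r.
  by case: (j < P)%N; rewrite ?mulr1 ?mul1r ?mulr0 ?mul0r.
- by rewrite mxE (negPf (_ : (k : nat) != j)) ?mulr0.
by rewrite mxE (negPf (_ : (i : nat) != k)) ?mul0r // eq_sym.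
Qed.

Section Truncation.

Variables (R : rcfType)
  (svd : forall m n, 'M[R]_(m, n) -> 'M[R]_m * 'M[R]_(m, n) * 'M[R]_n).
Hypothesis svdP : forall m n (A : 'M[R]_(m, n)), is_svd A (svd A).

(** The rectangular slices pair up into square projectors on both sides of [D]; the left one
    commutes past the diagonal [D] and merges with the right one. *)
Lemma tsvdE (P m n : nat) (A : 'M[R]_(m, n)) (U : 'M_m) D (V : 'M_n) :
  svd A = (U, D, V) -> tsvd svd P A = U *m D *m pid_mx P *m V^T.
Proof.
move=> svdA; have := svdP A; rewrite /tsvd svdA => -[_ _ _ [dD _ _]].
rewrite leading_blockE !first_colsE trmx_mul tr_pid_mx.
rewrite !mulmxA -(mulmxA U) pid_mx_id ?geq_minr // (minnC P m) pid_mx_minv.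
rewrite -[U *m _ *m _ *m _ *m _]mulmxA pid_mx_id ?geq_minr //.
rewrite (minnC P n) pid_mx_minv -(mulmxA U) diag_pid_mx // !mulmxA.
by rewrite -(mulmxA (U *m D)) mul_pid_mx minnn pid_mx_minv.
Qed.

(** Truncation projects onto the leading right singular vectors, so a left projector fixing [A] also
    fixes its truncation. *)
Lemma tsvd_mulr (P m n : nat) (A : 'M[R]_(m, n)) :
  exists B : 'M_n, tsvd svd P A = A *m B.
Proof.
case svdA: (svd A) => [[U D] V]; rewrite (tsvdE P svdA).
have := svdP A; rewrite svdA => -[_ VV -> _].
exists (V *m pid_mx P *m V^T); rewrite !mulmxA.
by rewrite -(mulmxA _ V^T V) VV mulmx1.
Qed.

(** The error is [U *m D *m copid_mx P *m V^T], and the orthogonal [U] and [V] drop out of the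
    trace. What remains has size [n], whatever the height of [A]. *)
Lemma sqnorm_tsvd_err (P m n : nat) (A : 'M[R]_(m, n)) (U : 'M_m) D (V : 'M_n) :
  svd A = (U, D, V) ->
  sqnorm (A - tsvd svd P A) = \tr (copid_mx P *m (D^T *m D) *m copid_mx P).
Proof.
move=> svdA; rewrite (tsvdE P svdA).
have := svdP A; rewrite svdA => -[UU VV AE _].
have -> : A - U *m D *m pid_mx P *m V^T = U *m D *m copid_mx P *m V^T.
  by rewrite {1}AE -mulmxBl /copid_mx mulmxBr mulmx1.
have sC : (copid_mx P)^T = copid_mx P :> 'M[R]_n.
  by rewrite /copid_mx linearB /= trmx1 tr_pid_mx.
rewrite /sqnorm !trmx_mul trmxK sC.
rewrite !mulmxA -(mulmxA _ U^T U) UU mulmx1.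
by rewrite mxtrace_mulC !mulmxA VV mul1mx.
Qed.

Lemma gram_svd (m n : nat) (A : 'M[R]_(m, n)) (U : 'M_m) D (V : 'M_n) :
  svd A = (U, D, V) ->
  [/\ A^T *m A = V *m (D^T *m D) *m V^T, V *m V^T = 1%:M, is_diag_mx (D^T *m D)
    & {homo (fun i => (D^T *m D) i i) : i j / (i <= j)%N >-> j <= i}].
Proof.
move=> svdA; have := svdP A; rewrite svdA => -[UU VV AE [/is_diag_mxP dD D0 sD]].
split.
- by rewrite AE !trmx_mul trmxK !mulmxA -(mulmxA _ U^T U) UU mulmx1.
- exact: mulmx1C.
- apply/is_diag_mxP => i j ij; rewrite mxE big1 // => k _; rewrite mxE.
  have [ki|/dD ->] := eqVneq (k : nat) i; last by rewrite mul0r.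
  by rewrite (dD k j) ?mulr0 // ki.
move=> i j ij; rewrite !mxE.
(* For [m <= j], column [j] of [D] is zero: the spectrum is padded by zeros. *)
have [jm|mj] := ltnP j m; last first.
  rewrite big1 => [|k _]; first by apply: sumr_ge0 => k _; rewrite mxE -expr2 sqr_ge0.
  rewrite mxE dD ?mul0r //; apply: contraTneq (ltn_ord k) => ->.
  by rewrite -leqNgt.
pose i0 := Ordinal (leq_ltn_trans ij jm); pose j0 := Ordinal jm.
rewrite (bigD1 j0) //= big1 ?addr0 => [|k kj]; last first.
  by rewrite mxE dD ?mul0r //.
rewrite [leRHS](bigD1 i0) //= !mxE.
have le0 : D j0 j <= D i0 i by apply: sD.
apply: le_trans (_ : D i0 i * D i0 i <= _); first exact: ler_pM.
by rewrite lerDl; apply: sumr_ge0 => k _; rewrite mxE -expr2 sqr_ge0.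
Qed.

(** Both Gram matrices are diagonalized in decreasing order, and scaling by [c >= 0] keeps that
    order, so uniqueness of the spectrum applies. The heights may differ, as those of [X *m W] and
    [M^+ W] do. *)
Lemma sqnorm_tsvd_err_gram (P m m' n : nat) (c : R)
    (A : 'M[R]_(m, n)) (B : 'M[R]_(m', n)) :
  0 <= c -> A^T *m A = c *: (B^T *m B) ->
  sqnorm (A - tsvd svd P A) = c * sqnorm (B - tsvd svd P B).
Proof.
move=> c0 AB.
case svdA: (svd A) => [[U D] V]; case svdB: (svd B) => [[U' E] V'].
rewrite (sqnorm_tsvd_err P svdA) (sqnorm_tsvd_err P svdB).
have [AE VV dD sD] := gram_svd svdA; have [BE VV' dE sE] := gram_svd svdB.
rewrite -mxtraceZ scalemxAl scalemxAr; congr (\tr (_ *m _ *m _)).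
apply: (sorted_diag_uniq dD _ sD _ VV VV').
- apply/is_diag_mxP => i j ij.
  by rewrite mxE (is_diag_mxP dE) // mulr0.
- by move=> i j ij; rewrite [leLHS]mxE [leRHS]mxE ler_wpM2l // sE.
by rewrite -AE AB BE -scalemxAr -scalemxAl.
Qed.

End Truncation.

Section Whitening.

Variables (R : rcfType) (N I : nat) (X : 'M[R]_(N, I)) (M : 'M[R]_I).
Hypothesis wM : whitening X M.

(** The trailing columns of [M] lie in the row space of [X] and, by the Gram identity, in the kernel
    of [X]; these are orthogonal, so the columns vanish. *)
Lemma whitening_pid : M *m pid_mx (\rank X) = M.
Proof.
have [gram /eqmxP rowM] := wM.
suff /eqP : M *m copid_mx (\rank X) = 0.
  by rewrite /copid_mx mulmxBr mulmx1 subr_eq0 => /eqP.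
set E := M *m _.
have XE : X *m E = 0.
  apply: gram_eq0; rewrite /E !trmx_mul !mulmxA.
  rewrite -3!(mulmxA (copid_mx _)^T) gram -mulmxA -scalemxAl.
  by rewrite mul_pid_mx_copid ?rank_leq_col // scaler0 mulmx0.
apply: gram_eq0.
have /submxP[B ->] : (E^T <= X)%MS.
  by rewrite trmx_mul -rowM mulmx_sub.
by rewrite -mulmxA XE mulmx0.
Qed.

(** The projector [M *m mpinv M] is symmetric and fixes [M], so acting on the right it fixes [M^T],
    whose rows span those of [X]. *)
Lemma whitening_mpinv : X *m (M *m mpinv M) = X.
Proof.
have [_ /eqmxP rowM] := wM; have [MM _ sMM _] := mpinvP M.
have /submxP[B XE] : (X <= M^T)%MS by rewrite rowM.
by rewrite XE -mulmxA -sMM -trmx_mul MM.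
Qed.

(** By symmetry of [mpinv M *m M], the matrix [mpinv M] factors as [M^T] times another matrix, and
    the projector fixes [M^T]. *)
Lemma pid_mpinv_whitening : pid_mx (\rank X) *m mpinv M = mpinv M.
Proof.
have [_ MMM _ sMM] := mpinvP M.
rewrite -MMM -sMM trmx_mul !mulmxA -[in LHS]tr_pid_mx.
by rewrite -(trmx_mul M) whitening_pid.
Qed.

Lemma sqnorm_whitening (n : nat) (E : 'M[R]_(I, n)) :
  pid_mx (\rank X) *m E = E -> sqnorm (X *m M *m E) = N%:R * sqnorm E.
Proof.
have [gram _] := wM; move=> pE.
rewrite /sqnorm !trmx_mul !mulmxA -3!(mulmxA E^T) gram -scalemxAr.
by rewrite -scalemxAl mxtraceZ -mulmxA pE.
Qed.

Lemma whitening_tsvd_err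
    (svd : forall m n, 'M[R]_(m, n) -> 'M[R]_m * 'M[R]_(m, n) * 'M[R]_n)
    (svdP : forall m n (A : 'M[R]_(m, n)), is_svd A (svd m n A))
    (P O : nat) (W : 'M[R]_(I, O)) :
  sqnorm (X *m W - tsvd svd P (X *m W)) =
  sqnorm (X *m W - X *m (M *m tsvd svd P (mpinv M *m W))).
Proof.
have [gram _] := wM; set Z := mpinv M *m W.
have pZ : pid_mx (\rank X) *m Z = Z by rewrite mulmxA pid_mpinv_whitening.
have XW : X *m W = X *m M *m Z by rewrite -mulmxA [M *m _]mulmxA mulmxA whitening_mpinv.
clearbody Z.
(* Both sides are [N] times the squared truncation error of [Z]: the right one by the scaling
   property of [X *m M], the left one by comparing Gram matrices. *)
rewrite [X in _ = sqnorm (X - _)]XW mulmxA -mulmxBr sqnorm_whitening; last first.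
  by have [B ->] := tsvd_mulr svdP P Z; rewrite mulmxBr mulmxA pZ.
apply: sqnorm_tsvd_err_gram => //.
rewrite XW !trmx_mul !mulmxA -3!(mulmxA Z^T) gram.
by rewrite -scalemxAr -scalemxAl -mulmxA pZ.
Qed.

End Whitening.

Theorem proposition4p6 (R : rcfType)
    (svd : forall m n, 'M[R]_(m, n) -> 'M[R]_m * 'M[R]_(m, n) * 'M[R]_n)
    (svdP : forall m n (A : 'M[R]_(m, n)), is_svd A (svd m n A))
    (G N I O : nat) (sX sW sY : seq nat)
    (f : tensor R sX -> tensor R sW -> tensor R sY)
    (Ob : tensor R [:: G; N; O] -> tensor R sY)
    (Ib : {linear tensor R sX -> tensor R [:: G; N; I]})
    (Pb : tensor R sW -> tensor R [:: G; I; O])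
    (hf : expressible f Ob Ib Pb)
    (X : tensor R sX) (W : tensor R sW)
    (M : 'I_G -> 'M[R]_I)
    (hM : forall g : 'I_G, whitening (slice (Ib X) g) (M g))
    (P : nat) (hP : (1 <= P <= minn I O)%N) :
  frobenius (bmul (Ib X) (Pb W) - btsvd svd P (bmul (Ib X) (Pb W))) =
  frobenius (bmul (Ib X) (Pb W) - bmul (Ib X) (taa svd P M (Pb W))).
Proof.
rewrite !frobenius_slice; congr Num.sqrt; apply: eq_bigr => g _.
by rewrite !sliceB !slice_batch; apply: whitening_tsvd_err.
Qed.
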